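(* For every session type $T$ let $[\![T]\!]=\{P\mid \vdash P:T\}$ be the set of closed processes typable with $T$ in the empty environment. Then for all session types $T,T'$: $T\leqslant T'$ if and only if $[\![T]\!]\subseteq[\![T']\!]$.
   Context: Expressions: $e::=x\mid v\mid \mathsf{succ}\,e\mid \mathsf{neg}\,e\mid \neg e\mid e_1\oplus e_2\mid e_1>e_2$, where values $v$ are natural numbers $n$, integers $i$, and $\mathsf{true},\mathsf{false}$. Processes: $P::=\mathsf p?\ell(x).P\mid \mathsf p!\ell(e).P\mid P+P\mid \mathsf{if}\ e\ \mathsf{then}\ P\ \mathsf{else}\ P\mid \mu X.P\mid X\mid \mathbf 0$ ($\mathsf p$ participants, $\ell$ labels, $X$ process variables; recursion guarded, $\mu X.P$ identified with its unfolding). $\sum_{i\in I}P_i$ denotes iterated $+$. Sorts $S::=\mathtt{nat}\mid\mathtt{int}\mid\mathtt{bool}$; subsorting $\leq:$ is the reflexive-transitive closure of $\mathtt{nat}\leq:\mathtt{int}$. Session types: $T::=\bigwedge_{i\in I}\mathsf p?\ell_i(S_i).T_i\mid\bigvee_{i\in I}\mathsf q!\ell_i(S_i).T_i\mid\mu\mathbf t.T\mid\mathbf t\mid\mathtt{end}$, with pairwise distinct labels in each intersection/union, guarded recursion, types with the same regular tree identified. Subtyping $\leqslant$ is the greatest relation on session types closed under: $\mathtt{end}\leqslant\mathtt{end}$; $\bigwedge_{i\in I\cup J}\mathsf p?\ell_i(S_i).T_i\leqslant\bigwedge_{i\in I}\mathsf p?\ell_i(S'_i).T'_i$ if for all $i\in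 I$: $S'_i\leq:S_i$ and $T_i\leqslant T'_i$; $\bigvee_{i\in I}\mathsf p!\ell_i(S_i).T_i\leqslant\bigvee_{i\in I\cup J}\mathsf p!\ell_i(S'_i).T'_i$ if for all $i\in I$: $S_i\leq:S'_i$ and $T_i\leqslant T'_i$. Typing: environments $\Gamma$ map expression variables to sorts and process variables to session types. Expressions: $\Gamma\vdash n:\mathtt{nat}$, $\Gamma\vdash i:\mathtt{int}$, $\Gamma\vdash\mathsf{true},\mathsf{false}:\mathtt{bool}$, $\Gamma,x:S\vdash x:S$; $\mathsf{succ}\,e:\mathtt{nat}$ if $e:\mathtt{nat}$; $\mathsf{neg}\,e:\mathtt{int}$ if $e:\mathtt{int}$; $\neg e:\mathtt{bool}$ if $e:\mathtt{bool}$; $e_1\oplus e_2:S$ if $e_1,e_2:S$; $e_1>e_2:\mathtt{bool}$ if $e_1,e_2:\mathtt{int}$; $e:S'$ if $e:S$ and $S\leq:S'$. Processes: if $\Gamma,x:S_i\vdash P_i:T_i$ for all $i\in I$ then $\Gamma\vdash\sum_{i\in I}\mathsf q?\ell_i(x).P_i:\bigwedge_{i\in I}\mathsf q?\ell_i(S_i).T_i$; $\Gamma\vdash\mathbf 0:\mathtt{end}$; if $\Gamma\vdash e:S$ and $\Gamma\vdash P:T$ then $\Gamma\vdash\mathsf q!\ell(e).P:\mathsf q!\ell(S).T$; if $\Gamma\vdash e:\mathtt{bool}$, $\Gamma\vdash P_1:T_1$, $\Gamma\vdash P_2:T_2$ then $\Gamma\vdash\mathsf{if}\ e\ \mathsf{then}\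 P_1\ \mathsf{else}\ P_2:T_1\vee T_2$; if $\Gamma,X:T\vdash P:T$ then $\Gamma\vdash\mu X.P:T$; $\Gamma,X:T\vdash X:T$; if $\Gamma\vdash P:T$ and $T\leqslant T'$ then $\Gamma\vdash P:T'$ (conclusions must be well-formed session types). *)

(* Defs.v *)
(* Stdlib only. All binders are de Bruijn indices: expression variables are
   bound by inputs, process variables by [PMu], type variables by [TMu]. *)
From Stdlib Require Import List ZArith Relations.
Import ListNotations.

(* Participants and labels range over countably infinite sets of names. *)
Definition participant := nat.
Definition label := nat.

Inductive value : Type :=
| VNat (n : nat)
| VInt (i : Z)
| VBool (b : bool).

Inductive expr : Type :=
| EVar (x : nat)
| EVal (v : value)
| ESucc (e : expr)
| ENeg (e : expr)
| ENot (e : expr)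
| EChoice (e1 e2 : expr)     (* e1 (+) e2 *)
| EGt (e1 e2 : expr).

Inductive proc : Type :=
| PIn (p : participant) (l : label) (P : proc)            (* binds one expression variable *)
| POut (p : participant) (l : label) (e : expr) (P : proc)
| PPlus (P Q : proc)
| PIf (e : expr) (P Q : proc)
| PMu (P : proc)                                          (* binds one process variable *)
| PVar (X : nat)
| PNil.

Definition up_ren (f : nat -> nat) (n : nat) : nat :=
  match n with 0 => 0 | S m => S (f m) end.

Fixpoint expr_ren (f : nat -> nat) (e : expr) : expr :=
  match e with
  | EVar x => EVar (f x)
  | EVal v => EVal v
  | ESucc e => ESucc (expr_ren f e)
  | ENeg e => ENeg (expr_ren f e)
  | ENot e => ENot (expr_ren f e)
  | EChoice e1 e2 => EChoice (expr_ren f e1) (expr_ren f e2)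
  | EGt e1 e2 => EGt (expr_ren f e1) (expr_ren f e2)
  end.

(* [f] acts on expression variables, [g] on process variables. *)
Fixpoint proc_ren (f g : nat -> nat) (P : proc) : proc :=
  match P with
  | PIn p l P => PIn p l (proc_ren (up_ren f) g P)
  | POut p l e P => POut p l (expr_ren f e) (proc_ren f g P)
  | PPlus P Q => PPlus (proc_ren f g P) (proc_ren f g Q)
  | PIf e P Q => PIf (expr_ren f e) (proc_ren f g P) (proc_ren f g Q)
  | PMu P => PMu (proc_ren f (up_ren g) P)
  | PVar X => PVar (g X)
  | PNil => PNil
  end.

Definition up_proc (s : nat -> proc) (X : nat) : proc :=
  match X with 0 => PVar 0 | S Y => proc_ren (fun x => x) S (s Y) end.

(* Capture-avoiding simultaneous substitution of process variables. *)
Fixpoint proc_subst (s : nat -> proc) (P : proc) : proc :=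
  match P with
  | PIn p l P => PIn p l (proc_subst (fun X => proc_ren S (fun Y => Y) (s X)) P)
  | POut p l e P => POut p l e (proc_subst s P)
  | PPlus P Q => PPlus (proc_subst s P) (proc_subst s Q)
  | PIf e P Q => PIf e (proc_subst s P) (proc_subst s Q)
  | PMu P => PMu (proc_subst (up_proc s) P)
  | PVar X => s X
  | PNil => PNil
  end.

(* P{mu X.P / X} *)
Definition proc_unfold (P : proc) : proc :=
  proc_subst (fun X => match X with 0 => PMu P | S Y => PVar Y end) P.

(* The identification of mu X.P with its unfolding: the least congruence
   containing it. *)
Inductive proc_eq : proc -> proc -> Prop :=
| peq_unfold P : proc_eq (PMu P) (proc_unfold P)
| peq_refl P : proc_eq P P
| peq_sym P Q : proc_eq P Q -> proc_eq Q P
| peq_trans P Q R : proc_eq P Q -> proc_eq Q R -> proc_eq P R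
| peq_in p l P P' : proc_eq P P' -> proc_eq (PIn p l P) (PIn p l P')
| peq_out p l e P P' : proc_eq P P' -> proc_eq (POut p l e P) (POut p l e P')
| peq_plus P P' Q Q' :
    proc_eq P P' -> proc_eq Q Q' -> proc_eq (PPlus P Q) (PPlus P' Q')
| peq_if e P P' Q Q' :
    proc_eq P P' -> proc_eq Q Q' -> proc_eq (PIf e P Q) (PIf e P' Q')
| peq_mu P P' : proc_eq P P' -> proc_eq (PMu P) (PMu P').

(* Every occurrence of the process variable [X] is under an input or output
   prefix. *)
Fixpoint proc_guards (X : nat) (P : proc) : Prop :=
  match P with
  | PIn _ _ _ | POut _ _ _ _ | PNil => True
  | PPlus P Q | PIf _ P Q => proc_guards X P /\ proc_guards X Q
  | PMu P => proc_guards (S X) P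
  | PVar Y => Y <> X
  end.

Fixpoint expr_scoped (m : nat) (e : expr) : Prop :=
  match e with
  | EVar x => x < m
  | EVal _ => True
  | ESucc e | ENeg e | ENot e => expr_scoped m e
  | EChoice e1 e2 | EGt e1 e2 => expr_scoped m e1 /\ expr_scoped m e2
  end.

(* At most [m] free expression variables, at most [k] free process variables,
   and all recursion guarded. *)
Fixpoint proc_wf (m k : nat) (P : proc) : Prop :=
  match P with
  | PIn _ _ P => proc_wf (S m) k P
  | POut _ _ e P => expr_scoped m e /\ proc_wf m k P
  | PPlus P Q => proc_wf m k P /\ proc_wf m k Q
  | PIf e P Q => expr_scoped m e /\ proc_wf m k P /\ proc_wf m k Q
  | PMu P => proc_guards 0 P /\ proc_wf m (S k) P
  | PVar X => X < k
  | PNil => True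
  end.

Definition closed_process (P : proc) : Prop := proc_wf 0 0 P.

(* [is_sum P Ps]: P is an iterated sum, with any bracketing, whose summands
   are Ps; Ps is nonempty. *)
Inductive is_sum : proc -> list proc -> Prop :=
| is_sum_one P : is_sum P [P]
| is_sum_plus P Q Ps Qs :
    is_sum P Ps -> is_sum Q Qs -> is_sum (PPlus P Q) (Ps ++ Qs).

Inductive sort : Type := SNat | SInt | SBool.

Inductive sort_step : sort -> sort -> Prop :=
| nat_int : sort_step SNat SInt.

Definition subsort : sort -> sort -> Prop := clos_refl_trans sort sort_step.

(* An entry (l, S, T) of a branch list is the branch l(S).T. *)
Inductive stype : Type :=
| TEnd
| TIn (p : participant) (bs : list (label * sort * stype))    (* intersection *)
| TOut (p : participant) (bs : list (label * sort * stype))   (* union *)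
| TMu (T : stype)
| TVar (t : nat).

Definition branches := list (label * sort * stype).

Definition labels (bs : branches) : list label := map (fun b => fst (fst b)) bs.

Fixpoint type_ren (f : nat -> nat) (T : stype) : stype :=
  match T with
  | TEnd => TEnd
  | TIn p bs => TIn p (map (fun b => (fst b, type_ren f (snd b))) bs)
  | TOut p bs => TOut p (map (fun b => (fst b, type_ren f (snd b))) bs)
  | TMu T => TMu (type_ren (up_ren f) T)
  | TVar t => TVar (f t)
  end.

Definition up_type (s : nat -> stype) (t : nat) : stype :=
  match t with 0 => TVar 0 | S u => type_ren S (s u) end.

Fixpoint type_subst (s : nat -> stype) (T : stype) : stype :=
  match T with
  | TEnd => TEnd
  | TIn p bs => TIn p (map (fun b => (fst b, type_subst s (snd b))) bs)
  | TOut p bs => TOut p (map (fun b => (fst b, type_subst s (snd b))) bs)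
  | TMu T => TMu (type_subst (up_type s) T)
  | TVar t => s t
  end.

(* T{mu t.T / t} *)
Definition type_unfold (T : stype) : stype :=
  type_subst (fun t => match t with 0 => TMu T | S u => TVar u end) T.

Fixpoint type_guards (t : nat) (T : stype) : Prop :=
  match T with
  | TEnd | TIn _ _ | TOut _ _ => True
  | TMu T => type_guards (S t) T
  | TVar u => u <> t
  end.

(* Index sets of intersections and unions are nonempty. *)
Definition branches_ok (bs : branches) : Prop := bs <> [] /\ NoDup (labels bs).

Inductive type_wf : nat -> stype -> Prop :=
| wf_end k : type_wf k TEnd
| wf_in k p bs :
    branches_ok bs -> (forall l S T, In (l, S, T) bs -> type_wf k T) ->
    type_wf k (TIn p bs)
| wf_out k p bs :
    branches_ok bs -> (forall l S T, In (l, S, T) bs -> type_wf k T) ->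
    type_wf k (TOut p bs)
| wf_mu k T : type_guards 0 T -> type_wf (S k) T -> type_wf k (TMu T)
| wf_var k t : t < k -> type_wf k (TVar t).

Definition session_type (T : stype) : Prop := type_wf 0 T.

(* [type_head T U]: unfolding the leading mu's of T gives U, which exposes the
   root of the tree of T. *)
Inductive type_head : stype -> stype -> Prop :=
| head_end : type_head TEnd TEnd
| head_in p bs : type_head (TIn p bs) (TIn p bs)
| head_out p bs : type_head (TOut p bs) (TOut p bs)
| head_mu T U : type_head (type_unfold T) U -> type_head (TMu T) U.

Definition branches_incl (R : stype -> stype -> Prop) (bs bs' : branches) : Prop :=
  forall l S T, In (l, S, T) bs -> exists T', In (l, S, T') bs' /\ R T T'.

(* Equality of the regular trees of two types, branches being unordered: this
   is the identification of types. *)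
CoInductive type_eq : stype -> stype -> Prop :=
| teq_end T T' : type_head T TEnd -> type_head T' TEnd -> type_eq T T'
| teq_in T T' p bs bs' :
    type_head T (TIn p bs) -> type_head T' (TIn p bs') ->
    branches_incl type_eq bs bs' ->
    branches_incl (fun U' U => type_eq U U') bs' bs ->
    type_eq T T'
| teq_out T T' p bs bs' :
    type_head T (TOut p bs) -> type_head T' (TOut p bs') ->
    branches_incl type_eq bs bs' ->
    branches_incl (fun U' U => type_eq U U') bs' bs ->
    type_eq T T'.

(* As types are identified with their trees, the rules are read at the roots. *)
CoInductive subtype : stype -> stype -> Prop :=
| sub_end T T' : type_head T TEnd -> type_head T' TEnd -> subtype T T'
| sub_in T T' p bs bs' :
    type_head T (TIn p bs) -> type_head T' (TIn p bs') ->
    (forall l S' U', In (l, S', U') bs' ->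
       exists S U, In (l, S, U) bs /\ subsort S' S /\ subtype U U') ->
    subtype T T'
| sub_out T T' p bs bs' :
    type_head T (TOut p bs) -> type_head T' (TOut p bs') ->
    (forall l S U, In (l, S, U) bs ->
       exists S' U', In (l, S', U') bs' /\ subsort S S' /\ subtype U U') ->
    subtype T T'.

(* [type_union T1 T2 T]: T is T1 \/ T2. Union is idempotent (on every type,
   including end and intersections) and otherwise joins two unions of outputs
   to the same participant. When T is a session type, labels common to T1 and
   T2 must therefore carry the same sort and the same continuation. *)
Inductive type_union (T1 T2 T : stype) : Prop :=
| union_idem : type_eq T1 T2 -> type_eq T1 T -> type_union T1 T2 T
| union_out p bs1 bs2 :
    type_head T1 (TOut p bs1) -> type_head T2 (TOut p bs2) ->
    type_eq (TOut p (bs1 ++ bs2)) T -> type_union T1 T2 T.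

Inductive expr_typing (G : list sort) : expr -> sort -> Prop :=
| et_nat n : expr_typing G (EVal (VNat n)) SNat
| et_int i : expr_typing G (EVal (VInt i)) SInt
| et_bool b : expr_typing G (EVal (VBool b)) SBool
| et_var x S : nth_error G x = Some S -> expr_typing G (EVar x) S
| et_succ e : expr_typing G e SNat -> expr_typing G (ESucc e) SNat
| et_neg e : expr_typing G e SInt -> expr_typing G (ENeg e) SInt
| et_not e : expr_typing G e SBool -> expr_typing G (ENot e) SBool
| et_choice e1 e2 S :
    expr_typing G e1 S -> expr_typing G e2 S -> expr_typing G (EChoice e1 e2) S
| et_gt e1 e2 :
    expr_typing G e1 SInt -> expr_typing G e2 SInt -> expr_typing G (EGt e1 e2) SBool
| et_sub e S S' : expr_typing G e S -> subsort S S' -> expr_typing G e S'.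

(* The environment is split into the sorts [G] of the expression variables and
   the session types [D] of the process variables. In [pt_in], an entry
   (l, S, P, T) of the family [I] stands for the summand q?l(x).P and the
   branch l(S).T. The rule [pt_eq] makes the judgement one about processes up
   to the identification of recursive processes with their unfoldings. *)
Inductive typing : list sort -> list stype -> proc -> stype -> Prop :=
| pt_in G D q (I : list (label * sort * proc * stype)) Q :
    is_sum Q (map (fun '(l, _, P, _) => PIn q l P) I) ->
    (forall l S P T, In (l, S, P, T) I -> typing (S :: G) D P T) ->
    session_type (TIn q (map (fun '(l, s, _, T) => (l, s, T)) I)) ->
    typing G D Q (TIn q (map (fun '(l, s, _, T) => (l, s, T)) I))
| pt_nil G D : typing G D PNil TEnd
| pt_out G D q l e P S T :
    expr_typing G e S -> typing G D P T ->
    typing G D (POut q l e P) (TOut q [(l, S, T)])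
| pt_if G D e P1 P2 T1 T2 T :
    expr_typing G e SBool -> typing G D P1 T1 -> typing G D P2 T2 ->
    type_union T1 T2 T -> session_type T ->
    typing G D (PIf e P1 P2) T
| pt_mu G D P T :
    session_type T -> typing G (T :: D) P T -> typing G D (PMu P) T
| pt_var G D X T : nth_error D X = Some T -> typing G D (PVar X) T
| pt_sub G D P T T' :
    typing G D P T -> subtype T T' -> session_type T' -> typing G D P T'
| pt_eq G D P Q T : proc_eq P Q -> typing G D P T -> typing G D Q T.

(* [[T]] *)
Definition denotation (T : stype) (P : proc) : Prop :=
  closed_process P /\ typing [] [] P T.

(* Main.v *)
(* Only "inclusion implies subtyping" needs work. Each session type T has a
   characteristic process [char T], of which T is the least type: an input tests
   the received variable with an operator that pins down its sort, an output
   sends a value whose least sort is the declared one, and a union becomes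
   a nested conditional. If [[T]] is included in [[T']] then [char T] has type T',
   and the pairs (T, T') such that [char T] has type T' satisfy the closure
   conditions defining subtyping. This last step inverts typing derivations, which
   may rewrite processes up to unfolding anywhere: inversion is therefore stated
   for the head obtained by unfolding leading recursions, which is preserved by
   the congruence up to congruence of its components. *)
From Stdlib Require Import List ZArith Relations Lia.
Require Import Defs.
Import ListNotations.

(** * Session types *)

(** The continuations sit inside lists of tuples, so a hypothesis for every branch comes from a
    fixpoint with an inner induction on the list. *)
Lemma stype_ind_nested (P : stype -> Prop) :
  P TEnd ->
  (forall p bs, (forall l s T, In (l, s, T) bs -> P T) -> P (TIn p bs)) ->
  (forall p bs, (forall l s T, In (l, s, T) bs -> P T) -> P (TOut p bs)) ->
  (forall T, P T -> P (TMu T)) ->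
  (forall t, P (TVar t)) ->
  forall T, P T.
Proof.
  intros Hend Hin Hout Hmu Hvar.
  fix IH 1.
  intros [|p bs|p bs|T|t]; [exact Hend| | |apply Hmu, IH|apply Hvar].
  - apply Hin. induction bs as [|[[l0 s0] T0] bs IHbs]; intros l s T H.
    + destruct H.
    + destruct H as [H|H]; [|exact (IHbs l s T H)].
      injection H as _ _ <-. apply IH.
  - apply Hout. induction bs as [|[[l0 s0] T0] bs IHbs]; intros l s T H.
    + destruct H.
    + destruct H as [H|H]; [|exact (IHbs l s T H)].
      injection H as _ _ <-. apply IH.
Qed.

(** * Renaming, substitution and well-formedness of types *)

Lemma map_branches_ext (f g : label * sort * stype -> stype) (bs : branches) :
  (forall l s T, In (l, s, T) bs -> f (l, s, T) = g (l, s, T)) ->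
  map (fun b => (fst b, f b)) bs = map (fun b => (fst b, g b)) bs.
Proof.
  intros H. apply map_ext_in. intros [[l s] T] Hb. simpl. now rewrite (H l s T Hb).
Qed.

Lemma in_map_branches (f : stype -> stype) (bs : branches) l s T :
  In (l, s, T) (map (fun b => (fst b, f (snd b))) bs) ->
  exists T0, In (l, s, T0) bs /\ T = f T0.
Proof.
  intros H. apply in_map_iff in H. destruct H as [[[l0 s0] T0] [E H]].
  simpl in E. injection E as -> -> <-. eauto.
Qed.

Lemma labels_map_branches (f : stype -> stype) (bs : branches) :
  labels (map (fun b => (fst b, f (snd b))) bs) = labels bs.
Proof. unfold labels. rewrite map_map. reflexivity. Qed.

Lemma branches_ok_map (f : stype -> stype) (bs : branches) :
  branches_ok bs -> branches_ok (map (fun b => (fst b, f (snd b))) bs).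
Proof.
  intros [H1 H2]. split.
  - intros E. apply map_eq_nil in E. contradiction.
  - now rewrite labels_map_branches.
Qed.

Lemma type_ren_ext f g T : (forall t, f t = g t) -> type_ren f T = type_ren g T.
Proof.
  revert f g.
  induction T as [|p bs IH|p bs IH|T IH|t] using stype_ind_nested; intros f g H; simpl.
  - reflexivity.
  - f_equal. apply map_branches_ext. simpl. eauto.
  - f_equal. apply map_branches_ext. simpl. eauto.
  - f_equal. apply IH. intros [|t]; simpl; auto.
  - now rewrite H.
Qed.

Lemma type_subst_ext s s' T : (forall t, s t = s' t) -> type_subst s T = type_subst s' T.
Proof.
  revert s s'.
  induction T as [|p bs IH|p bs IH|T IH|t] using stype_ind_nested; intros s s' H; simpl.
  - reflexivity.
  - f_equal. apply map_branches_ext. simpl. eauto.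
  - f_equal. apply map_branches_ext. simpl. eauto.
  - f_equal. apply IH. intros [|t]; simpl; [reflexivity|now rewrite H].
  - apply H.
Qed.

Lemma type_ren_ren f g T : type_ren f (type_ren g T) = type_ren (fun t => f (g t)) T.
Proof.
  revert f g.
  induction T as [|p bs IH|p bs IH|T IH|t] using stype_ind_nested; intros f g; simpl.
  - reflexivity.
  - f_equal. rewrite map_map. apply map_branches_ext. simpl. eauto.
  - f_equal. rewrite map_map. apply map_branches_ext. simpl. eauto.
  - f_equal. rewrite IH. apply type_ren_ext. now intros [|t].
  - reflexivity.
Qed.

Lemma type_ren_id f T : (forall t, f t = t) -> type_ren f T = T.
Proof.
  revert f.
  induction T as [|p bs IH|p bs IH|T IH|t] using stype_ind_nested; intros f H; simpl.
  - reflexivity.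
  - f_equal. rewrite <- (map_id bs) at 2. apply map_ext_in.
    intros [[l s] T] Hb. simpl. f_equal. eauto.
  - f_equal. rewrite <- (map_id bs) at 2. apply map_ext_in.
    intros [[l s] T] Hb. simpl. f_equal. eauto.
  - f_equal. apply IH. intros [|t]; simpl; auto.
  - now rewrite H.
Qed.

Lemma type_subst_id s T : (forall t, s t = TVar t) -> type_subst s T = T.
Proof.
  revert s.
  induction T as [|p bs IH|p bs IH|T IH|t] using stype_ind_nested; intros s H; simpl.
  - reflexivity.
  - f_equal. rewrite <- (map_id bs) at 2. apply map_ext_in.
    intros [[l s'] T] Hb. simpl. f_equal. eauto.
  - f_equal. rewrite <- (map_id bs) at 2. apply map_ext_in.
    intros [[l s'] T] Hb. simpl. f_equal. eauto.
  - f_equal. apply IH. intros [|t]; simpl; [reflexivity|now rewrite H].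
  - apply H.
Qed.

(* Every exchange law between renaming and substitution is an instance of this
   square. *)
Lemma type_ren_subst g g' s s' T :
  (forall t, s' (g' t) = type_ren g (s t)) ->
  type_ren g (type_subst s T) = type_subst s' (type_ren g' T).
Proof.
  revert g g' s s'.
  induction T as [|p bs IH|p bs IH|T IH|t] using stype_ind_nested;
    intros g g' s s' H; simpl.
  - reflexivity.
  - f_equal. rewrite !map_map. apply map_branches_ext. simpl. eauto.
  - f_equal. rewrite !map_map. apply map_branches_ext. simpl. eauto.
  - f_equal. apply IH. intros [|t]; simpl; [reflexivity|].
    rewrite H, !type_ren_ren. now apply type_ren_ext.
  - now rewrite H.
Qed.

Lemma type_subst_subst s s' T :
  type_subst s' (type_subst s T) = type_subst (fun t => type_subst s' (s t)) T.
Proof.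
  revert s s'.
  induction T as [|p bs IH|p bs IH|T IH|t] using stype_ind_nested; intros s s'; simpl.
  - reflexivity.
  - f_equal. rewrite map_map. apply map_branches_ext. simpl. eauto.
  - f_equal. rewrite map_map. apply map_branches_ext. simpl. eauto.
  - f_equal. rewrite IH. apply type_subst_ext. intros [|t]; simpl; [reflexivity|].
    symmetry. now apply type_ren_subst.
  - reflexivity.
Qed.

Lemma type_subst_ren s g T : type_subst s (type_ren g T) = type_subst (fun t => s (g t)) T.
Proof.
  (* An identity renaming is inserted to make this an instance of the square [type_ren_subst]. *)
  rewrite <- (type_ren_id (fun t => t) (type_subst (fun t => s (g t)) T)) by reflexivity.
  symmetry. apply type_ren_subst. intros t. now rewrite type_ren_id.
Qed.

(** Merges the two substitutions into one that sends the bound variable to the recursive type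
    itself, the form met when a recursive body is typed in [char_typing]. *)
Lemma type_unfold_up s T :
  type_unfold (type_subst (up_type s) T) =
  type_subst (fun t => match t with 0 => TMu (type_subst (up_type s) T) | S u => s u end) T.
Proof.
  unfold type_unfold at 1. rewrite type_subst_subst. apply type_subst_ext.
  intros [|t]; simpl; [reflexivity|].
  rewrite type_subst_ren. now apply type_subst_id.
Qed.

Lemma type_guards_ren f t t' T :
  (forall u, u <> t -> f u <> t') -> type_guards t T -> type_guards t' (type_ren f T).
Proof.
  revert f t t'.
  induction T as [|p bs IH|p bs IH|T IH|u] using stype_ind_nested;
    intros f t t' H HT; simpl in *; auto.
  apply (IH _ (S t)); [|exact HT].
  intros [|u] Hu; simpl; [lia|]. intros E. injection E. apply H. lia.
Qed.

Lemma type_guards_ren_notin f t T :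
  (forall u, f u <> t) -> type_guards t (type_ren f T).
Proof.
  revert f t.
  induction T as [|p bs IH|p bs IH|T IH|u] using stype_ind_nested;
    intros f t H; simpl in *; auto.
  apply IH. intros [|u]; simpl; [lia|]. intros E. injection E. apply H.
Qed.

Lemma type_guards_subst s t t' T :
  (forall u, u <> t -> type_guards t' (s u)) ->
  type_guards t T -> type_guards t' (type_subst s T).
Proof.
  revert s t t'.
  induction T as [|p bs IH|p bs IH|T IH|u] using stype_ind_nested;
    intros s t t' H HT; simpl in *; auto.
  apply (IH _ (S t)); [|exact HT].
  intros [|u] Hu; simpl; [lia|].
  apply (type_guards_ren _ t'); [lia|]. apply H. lia.
Qed.

Lemma type_wf_ren f k j T :
  (forall t, t < k -> f t < j) ->
  (forall t u, f t = f u -> t = u) ->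
  type_wf k T -> type_wf j (type_ren f T).
Proof.
  revert f k j.
  induction T as [|p bs IH|p bs IH|T IH|u] using stype_ind_nested;
    intros f k j Hf Hinj HT; inversion HT; subst; simpl.
  - constructor.
  - constructor; [now apply branches_ok_map|].
    intros l s T H. apply in_map_branches in H. destruct H as [T0 [H ->]]. eauto.
  - constructor; [now apply branches_ok_map|].
    intros l s T H. apply in_map_branches in H. destruct H as [T0 [H ->]]. eauto.
  - constructor.
    + apply (type_guards_ren _ 0); [|assumption]. intros [|u]; simpl; lia.
    + apply (IH _ (S k)); [| |assumption].
      * intros [|t] Ht; simpl; [lia|]. specialize (Hf t). lia.
      * intros [|t] [|u] E; simpl in E; try discriminate; [reflexivity|].
        f_equal. apply Hinj. now injection E.
  - constructor. auto.
Qed.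

Lemma type_wf_subst s k j T :
  (forall t, t < k -> type_wf j (s t)) ->
  type_wf k T -> type_wf j (type_subst s T).
Proof.
  revert s k j.
  induction T as [|p bs IH|p bs IH|T IH|u] using stype_ind_nested;
    intros s k j Hs HT; inversion HT; subst; simpl.
  - constructor.
  - constructor; [now apply branches_ok_map|].
    intros l s' T H. apply in_map_branches in H. destruct H as [T0 [H ->]]. eauto.
  - constructor; [now apply branches_ok_map|].
    intros l s' T H. apply in_map_branches in H. destruct H as [T0 [H ->]]. eauto.
  - constructor.
    + apply (type_guards_subst _ 0); [|assumption].
      intros [|u] Hu; [lia|]. apply type_guards_ren_notin. lia.
    + apply (IH _ (S k)); [|assumption].
      intros [|t] Ht; simpl; [constructor; lia|].
      apply (type_wf_ren _ j); [lia| |apply Hs; lia].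
      intros t' u E. now injection E.
  - auto.
Qed.

Lemma type_wf_unfold k T : type_wf k (TMu T) -> type_wf k (type_unfold T).
Proof.
  intros H. inversion H; subst. apply (type_wf_subst _ (S k)); [|assumption].
  intros [|t] Ht; [assumption|]. constructor. lia.
Qed.

(** * Heads of session types *)

Lemma type_head_session T U : type_head T U -> session_type T -> session_type U.
Proof. induction 1; auto. intros HT. now apply IHtype_head, type_wf_unfold. Qed.

(** The measure by which head computation terminates: unfolding a guarded recursion lowers it by
    one. *)
Fixpoint leading_mus (T : stype) : nat :=
  match T with TMu T => S (leading_mus T) | _ => 0 end.

Lemma leading_mus_ren f T : leading_mus (type_ren f T) = leading_mus T.
Proof.
  revert f. induction T using stype_ind_nested; intros f; simpl; auto.
Qed.

(** New leading mu's can only enter through a variable lying under leading mu's alone, which is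
    precisely an unguarded one. *)
Lemma leading_mus_subst s T :
  (forall t, ~ type_guards t T -> leading_mus (s t) = 0) ->
  leading_mus (type_subst s T) = leading_mus T.
Proof.
  revert s.
  induction T as [|p bs IH|p bs IH|T IH|u] using stype_ind_nested; intros s H; simpl; auto.
  f_equal. apply IH. intros [|t] Ht; simpl; [reflexivity|].
  rewrite leading_mus_ren. now apply H.
Qed.

Lemma type_head_exists T : session_type T -> exists U, type_head T U.
Proof.
  enough (forall n T, leading_mus T = n -> session_type T -> exists U, type_head T U) by eauto.
  clear T. induction n as [|n IH]; intros [|p bs|p bs|T|t] Hn HT; try discriminate;
    try (eexists; constructor; fail).
  - inversion HT. lia.
  - simpl in Hn. injection Hn as Hn.
    destruct (IH (type_unfold T)) as [U HU].
    + rewrite <- Hn. apply leading_mus_subst. inversion HT; subst.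
      intros [|t]; [contradiction|reflexivity].
    + now apply type_wf_unfold.
    + exists U. now constructor.
Qed.

Lemma type_head_det T U U' : type_head T U -> type_head T U' -> U = U'.
Proof.
  intros H. revert U'.
  induction H; intros U' H'; inversion H'; subst; auto.
Qed.

Lemma session_type_in p bs l s T : session_type (TIn p bs) -> In (l, s, T) bs -> session_type T.
Proof. unfold session_type. intros H Hb. inversion H; subst. eauto. Qed.

Lemma session_type_out p bs l s T : session_type (TOut p bs) -> In (l, s, T) bs -> session_type T.
Proof. unfold session_type. intros H Hb. inversion H; subst. eauto. Qed.

(** * Subsorting, equality of types and subtyping *)

Lemma subsort_refl s : subsort s s.
Proof. apply rt_refl. Qed.

Lemma subsort_trans s1 s2 s3 : subsort s1 s2 -> subsort s2 s3 -> subsort s1 s3.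
Proof. apply rt_trans. Qed.

(** One layer of [type_eq] with the recursive occurrences abstracted, so that later proofs exhibit a
    bisimulation and the guardedness of [cofix] is dealt with once, in [type_eq_coind]. *)
Variant type_eq_step (R : stype -> stype -> Prop) (T T' : stype) : Prop :=
| tes_end : type_head T TEnd -> type_head T' TEnd -> type_eq_step R T T'
| tes_in p bs bs' :
    type_head T (TIn p bs) -> type_head T' (TIn p bs') ->
    branches_incl R bs bs' -> branches_incl (fun U' U => R U U') bs' bs ->
    type_eq_step R T T'
| tes_out p bs bs' :
    type_head T (TOut p bs) -> type_head T' (TOut p bs') ->
    branches_incl R bs bs' -> branches_incl (fun U' U => R U U') bs' bs ->
    type_eq_step R T T'.

Lemma type_eq_coind (R : stype -> stype -> Prop) :
  (forall T T', R T T' -> type_eq_step R T T') ->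
  forall T T', R T T' -> type_eq T T'.
Proof.
  intros HR. cofix CIH. intros T T' H.
  destruct (HR _ _ H) as [h h'|p bs bs' h h' i i'|p bs bs' h h' i i'].
  - now apply teq_end.
  - eapply teq_in; [exact h|exact h'| |].
    + intros l s U Hb. destruct (i l s U Hb) as [U' [Hb' HU]].
      exists U'. split; [exact Hb'|exact (CIH _ _ HU)].
    + intros l s U Hb. destruct (i' l s U Hb) as [U' [Hb' HU]].
      exists U'. split; [exact Hb'|exact (CIH _ _ HU)].
  - eapply teq_out; [exact h|exact h'| |].
    + intros l s U Hb. destruct (i l s U Hb) as [U' [Hb' HU]].
      exists U'. split; [exact Hb'|exact (CIH _ _ HU)].
    + intros l s U Hb. destruct (i' l s U Hb) as [U' [Hb' HU]].
      exists U'. split; [exact Hb'|exact (CIH _ _ HU)].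
Qed.

Variant subtype_step (R : stype -> stype -> Prop) (T T' : stype) : Prop :=
| ss_end : type_head T TEnd -> type_head T' TEnd -> subtype_step R T T'
| ss_in p bs bs' :
    type_head T (TIn p bs) -> type_head T' (TIn p bs') ->
    (forall l s' U', In (l, s', U') bs' ->
       exists s U, In (l, s, U) bs /\ subsort s' s /\ R U U') ->
    subtype_step R T T'
| ss_out p bs bs' :
    type_head T (TOut p bs) -> type_head T' (TOut p bs') ->
    (forall l s U, In (l, s, U) bs ->
       exists s' U', In (l, s', U') bs' /\ subsort s s' /\ R U U') ->
    subtype_step R T T'.

Lemma subtype_coind (R : stype -> stype -> Prop) :
  (forall T T', R T T' -> subtype_step R T T') ->
  forall T T', R T T' -> subtype T T'.
Proof.
  intros HR. cofix CIH. intros T T' H.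
  destruct (HR _ _ H) as [h h'|p bs bs' h h' i|p bs bs' h h' i].
  - now apply sub_end.
  - eapply sub_in; [exact h|exact h'|].
    intros l s' U' Hb. destruct (i l s' U' Hb) as [s [U [Hb' [Hs HU]]]].
    exists s, U. split; [exact Hb'|split; [exact Hs|exact (CIH _ _ HU)]].
  - eapply sub_out; [exact h|exact h'|].
    intros l s U Hb. destruct (i l s U Hb) as [s' [U' [Hb' [Hs HU]]]].
    exists s', U'. split; [exact Hb'|split; [exact Hs|exact (CIH _ _ HU)]].
Qed.

(** A common head gives literally the same branches, and each continuation is related to itself:
    being a session type, it has a head of its own. *)
Lemma type_eq_same_head T T' U :
  type_head T U -> type_head T' U -> session_type U -> type_eq T T'.
Proof.
  intros HT HT' HU.
  apply (type_eq_coind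
    (fun T T' => exists U, type_head T U /\ type_head T' U /\ session_type U));
    [|eauto].
  clear. intros T T' [U [HT [HT' HU]]].
  assert (Hrefl : forall V, session_type V ->
    exists W, type_head V W /\ type_head V W /\ session_type W).
  { intros V HV. destruct (type_head_exists V HV) as [W HW].
    exists W. eauto using type_head_session. }
  destruct U as [|p bs|p bs|U|t].
  - now apply tes_end.
  - apply (tes_in _ _ _ p bs bs); auto; intros l s V Hb; exists V;
      (split; [exact Hb|]); eapply Hrefl, session_type_in; eauto.
  - apply (tes_out _ _ _ p bs bs); auto; intros l s V Hb; exists V;
      (split; [exact Hb|]); eapply Hrefl, session_type_out; eauto.
  - exfalso. clear -HT. remember (TMu U) as V eqn:E. induction HT; congruence || auto.
  - exfalso. clear -HT. remember (TVar t) as V eqn:E. induction HT; congruence || auto.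
Qed.

Lemma type_eq_refl T : session_type T -> type_eq T T.
Proof.
  intros HT. destruct (type_head_exists T HT) as [U HU].
  eauto using type_eq_same_head, type_head_session.
Qed.

Lemma type_eq_unfold T : session_type (TMu T) -> type_eq (type_unfold T) (TMu T).
Proof.
  intros HT. destruct (type_head_exists _ HT) as [U HU].
  inversion HU; subst. eauto using type_eq_same_head, type_head_session.
Qed.

Lemma type_eq_sym T T' : type_eq T T' -> type_eq T' T.
Proof.
  intros H. apply (type_eq_coind (fun T T' => type_eq T' T)); [|assumption].
  clear. intros T T' [? ? h h'|? ? p bs bs' h h' i i'|? ? p bs bs' h h' i i'].
  - now apply tes_end.
  - eapply tes_in; eauto.
  - eapply tes_out; eauto.
Qed.

Lemma type_eq_trans T1 T2 T3 : type_eq T1 T2 -> type_eq T2 T3 -> type_eq T1 T3.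
Proof.
  intros H1 H2.
  apply (type_eq_coind (fun T1 T3 => exists T2, type_eq T1 T2 /\ type_eq T2 T3)); [|eauto].
  clear. intros T1 T3 [T2 [H12 H23]].
  assert (Hincl : forall R R' bs1 bs2 bs3, branches_incl R bs1 bs2 -> branches_incl R' bs2 bs3 ->
    branches_incl (fun U1 U3 => exists U2, R U1 U2 /\ R' U2 U3) bs1 bs3).
  { intros R R' bs1 bs2 bs3 i j l s U1 Hb.
    destruct (i _ _ _ Hb) as [U2 [Hb2 HU2]]. destruct (j _ _ _ Hb2) as [U3 [Hb3 HU3]]. eauto. }
  (* The backward inclusions compose from [bs3] to [bs1], which yields the two halves around the
     midpoint in the opposite order. *)
  assert (Hswap : forall (R R' : stype -> stype -> Prop) bs3 bs1,
    branches_incl (fun U3 U1 => exists U2, R U2 U3 /\ R' U1 U2) bs3 bs1 ->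
    branches_incl (fun U3 U1 => exists U2, R' U1 U2 /\ R U2 U3) bs3 bs1).
  { intros R R' bs3 bs1 i l s U Hb. destruct (i _ _ _ Hb) as [U' [Hb' [U2 [? ?]]]]. eauto. }
  destruct H12 as [? ? h1 h2|? ? p bs1 bs2 h1 h2 i i'|? ? p bs1 bs2 h1 h2 i i'];
    destruct H23 as [? ? h2' h3|? ? q bs2' bs3 h2' h3 j j'|? ? q bs2' bs3 h2' h3 j j'];
    pose proof (type_head_det _ _ _ h2 h2') as E; try discriminate E.
  - now apply tes_end.
  - injection E as <- <-. eapply tes_in; eauto.
  - injection E as <- <-. eapply tes_out; eauto.
Qed.

Lemma type_eq_subtype T T' : type_eq T T' -> subtype T T'.
Proof.
  apply (subtype_coind type_eq). clear.
  intros T T' [? ? h h'|? ? p bs bs' h h' i i'|? ? p bs bs' h h' i i'].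
  - now apply ss_end.
  - eapply ss_in; eauto. intros l s U Hb. destruct (i' _ _ _ Hb) as [U' [Hb' HU]].
    exists s, U'. auto using subsort_refl.
  - eapply ss_out; eauto. intros l s U Hb. destruct (i _ _ _ Hb) as [U' [Hb' HU]].
    exists s, U'. auto using subsort_refl.
Qed.

(** In the idempotent case both operands are equal to [T]; otherwise this is width subtyping, as the
    branches of each operand occur in the concatenation. *)
Lemma type_union_subtype T1 T2 T : type_union T1 T2 T -> subtype T1 T /\ subtype T2 T.
Proof.
  intros [E1 E2|p bs1 bs2 h1 h2 E].
  - split; apply type_eq_subtype; [assumption|].
    eauto using type_eq_trans, type_eq_sym.
  - inversion E as [? ? h h'|? ? q bs bs' h h' i i'|? ? q bs bs' h h' i i']; subst;
      inversion h; subst.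
    split; eapply sub_out; eauto; intros l s U Hb;
      destruct (i l s U) as [U' [Hb' HU]];
      try (apply in_or_app; auto; fail);
      exists s, U'; auto using subsort_refl, type_eq_subtype.
Qed.

(** * Processes up to unfolding *)

Lemma expr_ren_ext f g e : (forall x, f x = g x) -> expr_ren f e = expr_ren g e.
Proof. intros H. induction e; simpl; congruence. Qed.

Lemma expr_ren_ren f g e : expr_ren f (expr_ren g e) = expr_ren (fun x => f (g x)) e.
Proof. induction e; simpl; congruence. Qed.

Lemma expr_ren_id f e : (forall x, f x = x) -> expr_ren f e = e.
Proof. intros H. induction e; simpl; congruence. Qed.

Lemma up_ren_ext f g : (forall x, f x = g x) -> forall x, up_ren f x = up_ren g x.
Proof. intros H [|x]; simpl; auto. Qed.

Lemma up_ren_id f : (forall x, f x = x) -> forall x, up_ren f x = x.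
Proof. intros H [|x]; simpl; auto. Qed.

Lemma proc_ren_ext f f' g g' P :
  (forall x, f x = f' x) -> (forall X, g X = g' X) -> proc_ren f g P = proc_ren f' g' P.
Proof.
  revert f f' g g'. induction P; intros f f' g g' Hf Hg; simpl; f_equal;
    auto using expr_ren_ext, up_ren_ext.
Qed.

Lemma proc_ren_ren f f' g g' P :
  proc_ren f' g' (proc_ren f g P) = proc_ren (fun x => f' (f x)) (fun X => g' (g X)) P.
Proof.
  revert f f' g g'. induction P; intros f f' g g'; simpl; f_equal; auto using expr_ren_ren;
    rewrite IHP; apply proc_ren_ext; now intros [|x].
Qed.

Lemma proc_ren_id f g P :
  (forall x, f x = x) -> (forall X, g X = X) -> proc_ren f g P = P.
Proof.
  revert f g. induction P; intros f g Hf Hg; simpl; f_equal;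
    auto using expr_ren_id, up_ren_id.
Qed.

Lemma proc_subst_ext s s' P : (forall X, s X = s' X) -> proc_subst s P = proc_subst s' P.
Proof.
  revert s s'. induction P; intros s s' H; simpl; f_equal; auto; apply IHP.
  - intros X. now rewrite H.
  - intros [|X]; simpl; [reflexivity|now rewrite H].
Qed.

Lemma proc_subst_id s P : (forall X, s X = PVar X) -> proc_subst s P = P.
Proof.
  revert s. induction P; intros s H; simpl; f_equal; auto; apply IHP.
  - intros X. now rewrite H.
  - intros [|X]; simpl; [reflexivity|now rewrite H].
Qed.

(** The counterpart for processes of the square [type_ren_subst]; under an input the shift of
    expression variables must also commute with [f]. *)
Lemma proc_ren_subst f g g' s s' P :
  (forall X, s' (g' X) = proc_ren f g (s X)) ->
  proc_ren f g (proc_subst s P) = proc_subst s' (proc_ren f g' P).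
Proof.
  revert f g g' s s'. induction P; intros f g g' s s' H; simpl; f_equal; auto; apply IHP.
  - intros Y. rewrite H, !proc_ren_ren. now apply proc_ren_ext.
  - intros [|Y]; simpl; [reflexivity|].
    rewrite H, !proc_ren_ren. now apply proc_ren_ext.
Qed.

Lemma proc_subst_ren s g P :
  proc_subst s (proc_ren (fun x => x) g P) = proc_subst (fun X => s (g X)) P.
Proof.
  rewrite <- (proc_ren_id (fun x => x) (fun X => X) (proc_subst (fun X => s (g X)) P))
    by reflexivity.
  symmetry. apply proc_ren_subst. intros X. now rewrite proc_ren_id.
Qed.

Lemma proc_subst_subst s s' P :
  proc_subst s' (proc_subst s P) = proc_subst (fun X => proc_subst s' (s X)) P.
Proof.
  revert s s'. induction P; intros s s'; simpl; f_equal; auto; rewrite IHP;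
    apply proc_subst_ext.
  - intros X. symmetry. now apply proc_ren_subst.
  - intros [|X]; simpl; [reflexivity|]. symmetry. now apply proc_ren_subst.
Qed.

Definition unfolding (P : proc) (X : nat) : proc :=
  match X with 0 => PMu P | S Y => PVar Y end.

Lemma proc_ren_unfold f g P :
  proc_ren f g (proc_unfold P) = proc_unfold (proc_ren f (up_ren g) P).
Proof. apply proc_ren_subst. now intros [|X]. Qed.

Lemma proc_subst_unfold s P :
  proc_subst s (proc_unfold P) = proc_unfold (proc_subst (up_proc s) P).
Proof.
  unfold proc_unfold at 1 2. rewrite !proc_subst_subst. apply proc_subst_ext.
  intros [|X]; simpl; [reflexivity|].
  rewrite proc_subst_ren. symmetry. now apply proc_subst_id.
Qed.

Lemma proc_eq_ren f g P Q : proc_eq P Q -> proc_eq (proc_ren f g P) (proc_ren f g Q).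
Proof.
  intros H. revert f g. induction H; intros f g; simpl; eauto using proc_eq.
  rewrite proc_ren_unfold. apply peq_unfold.
Qed.

Lemma proc_eq_subst_l s P Q : proc_eq P Q -> proc_eq (proc_subst s P) (proc_subst s Q).
Proof.
  intros H. revert s. induction H; intros s; simpl; eauto using proc_eq.
  rewrite proc_subst_unfold. apply peq_unfold.
Qed.

Lemma proc_eq_subst_r s s' P :
  (forall X, proc_eq (s X) (s' X)) -> proc_eq (proc_subst s P) (proc_subst s' P).
Proof.
  revert s s'. induction P; intros s s' H; simpl;
    auto using peq_out, peq_plus, peq_if, peq_refl.
  - apply peq_in, IHP. intros X. apply proc_eq_ren, H.
  - apply peq_mu, IHP. intros [|X]; simpl; [apply peq_refl|apply proc_eq_ren, H].
Qed.

Lemma proc_eq_subst s s' P Q :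
  proc_eq P Q -> (forall X, proc_eq (s X) (s' X)) ->
  proc_eq (proc_subst s P) (proc_subst s' Q).
Proof. eauto using peq_trans, proc_eq_subst_l, proc_eq_subst_r. Qed.

(** * Heads of processes and their stability under the congruence *)

Definition is_mu (P : proc) : Prop := match P with PMu _ => True | _ => False end.

(* [proc_head n P H]: after [n] unfoldings of leading mu's, P becomes H. An
   unguarded recursion such as mu X.X has no head. *)
Inductive proc_head : nat -> proc -> proc -> Prop :=
| ph_here P : ~ is_mu P -> proc_head 0 P P
| ph_mu n P H : proc_head n (proc_unfold P) H -> proc_head (S n) (PMu P) H.

Lemma proc_head_not_mu n P H : proc_head n P H -> ~ is_mu H.
Proof. now induction 1. Qed.

(** The count is determined along with the head. A process met again while computing its own head
    would have two counts, which excludes looping. *)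
Lemma proc_head_det n n' P H H' :
  proc_head n P H -> proc_head n' P H' -> n = n' /\ H = H'.
Proof.
  intros HP. revert n' H'. induction HP as [P HP|n P H HP IH]; intros n' H' HP'.
  - inversion HP'; subst; [auto|]. now elim HP.
  - inversion HP' as [? h|n0 ? ? h]; subst.
    + now elim h.
    + destruct (IH _ _ h). auto.
Qed.

Lemma proc_head_subst n s P H :
  proc_head n P H -> ~ is_mu (proc_subst s H) ->
  proc_head n (proc_subst s P) (proc_subst s H).
Proof.
  induction 1 as [P HP|n P H HP IH]; intros Hs; simpl; constructor; auto.
  rewrite <- proc_subst_unfold. auto.
Qed.

(** The computation splits in two: unfoldings already possible in [P], up to a head [H0], and then,
    if [H0] is a variable, those of the process put in its place. *)
Lemma proc_head_subst_inv n s P H :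
  proc_head n (proc_subst s P) H ->
  exists m n' H0, n = m + n' /\ proc_head m P H0 /\ proc_head n' (proc_subst s H0) H.
Proof.
  intros HP. remember (proc_subst s P) as Q eqn:E. revert P E.
  induction HP as [Q HQ|n Q H HQ IH]; intros P E.
  - subst Q. exists 0, 0, P. repeat split; constructor; auto.
    destruct P; simpl in *; auto.
  - destruct P as [| | | |P|X|]; try discriminate E.
    + injection E as ->. rewrite <- proc_subst_unfold in HQ, IH.
      destruct (IH _ eq_refl) as [m [n' [H0 [-> [Hm Hn']]]]].
      exists (S m), n', H0. repeat split; auto. now constructor.
    + exists 0, (S n), (PVar X). repeat split; [constructor; auto|].
      simpl in *. rewrite <- E. now constructor.
Qed.

(* If the head of P were X itself, unfolding mu X.P would loop, so the head of
   mu X.P is an instance of the head of P. *)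
Lemma proc_head_mu_inv n P H :
  proc_head n (PMu P) H ->
  exists m H0, proc_head m P H0 /\ H0 <> PVar 0 /\ H = proc_subst (unfolding P) H0.
Proof.
  intros HP. inversion HP as [? h|k ? ? h]; subst; [now elim h|].
  destruct (proc_head_subst_inv _ _ _ _ h) as [m [n' [H0 [E [Hm Hn']]]]].
  exists m, H0. split; [exact Hm|].
  assert (N : H0 <> PVar 0).
  { intros ->. simpl in Hn'. destruct (proc_head_det _ _ _ _ _ HP Hn'). lia. }
  split; [exact N|].
  pose proof (proc_head_not_mu _ _ _ Hm) as Hmu.
  destruct H0 as [| | | | |[|X]|]; simpl in Hmu; try tauto;
    inversion Hn'; subst; reflexivity.
Qed.

Lemma unfolding_not_mu P H0 : ~ is_mu H0 -> H0 <> PVar 0 -> ~ is_mu (proc_subst (unfolding P) H0).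
Proof. destruct H0 as [| | | | |[|X]|]; simpl; auto. Qed.

(** Converse of [proc_head_mu_inv]; the two together carry heads through the rule [peq_mu]. *)
Lemma proc_head_mu n P H0 :
  proc_head n P H0 -> H0 <> PVar 0 -> proc_head (S n) (PMu P) (proc_subst (unfolding P) H0).
Proof.
  intros HP N. constructor. apply proc_head_subst; [exact HP|].
  eauto using unfolding_not_mu, proc_head_not_mu.
Qed.

(** The congruence confined to the immediate components, with the root kept fixed. There is no
    clause for [PMu], since a head is never a recursion. *)
Inductive head_eq : proc -> proc -> Prop :=
| he_in p l P P' : proc_eq P P' -> head_eq (PIn p l P) (PIn p l P')
| he_out p l e P P' : proc_eq P P' -> head_eq (POut p l e P) (POut p l e P')
| he_plus P P' Q Q' : proc_eq P P' -> proc_eq Q Q' -> head_eq (PPlus P Q) (PPlus P' Q')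
| he_if e P P' Q Q' : proc_eq P P' -> proc_eq Q Q' -> head_eq (PIf e P Q) (PIf e P' Q')
| he_var X : head_eq (PVar X) (PVar X)
| he_nil : head_eq PNil PNil.

Lemma head_eq_refl P : ~ is_mu P -> head_eq P P.
Proof. destruct P; intros H; try (elim H; exact I); constructor; apply peq_refl. Qed.

Lemma head_eq_sym P Q : head_eq P Q -> head_eq Q P.
Proof. destruct 1; constructor; auto using peq_sym. Qed.

Lemma head_eq_trans P Q R : head_eq P Q -> head_eq Q R -> head_eq P R.
Proof.
  intros H H'. destruct H; inversion H'; subst; constructor; eauto using peq_trans.
Qed.

Lemma head_eq_unfolding P P' H H' :
  proc_eq P P' -> head_eq H H' -> H <> PVar 0 ->
  head_eq (proc_subst (unfolding P) H) (proc_subst (unfolding P') H').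
Proof.
  intros HP HH N.
  assert (Hs : forall X, proc_eq (unfolding P X) (unfolding P' X)).
  { intros [|X]; [now apply peq_mu|apply peq_refl]. }
  destruct HH as [| | | |[|X]|]; simpl; try constructor;
    auto using proc_eq_subst, proc_eq_ren.
  now elim N.
Qed.

(** The two counts may differ, because [peq_unfold] changes the number of unfoldings. *)
Definition heads_below (P Q : proc) : Prop :=
  forall n H, proc_head n P H -> exists m H', proc_head m Q H' /\ head_eq H H'.

Lemma heads_below_same P Q : ~ is_mu P -> ~ is_mu Q -> head_eq P Q -> heads_below P Q.
Proof.
  intros HP HQ E n H HH. inversion HH; subst; [|now elim HP].
  exists 0, Q. split; [now constructor|assumption].
Qed.

Lemma heads_below_mu P P' : proc_eq P P' -> heads_below P P' -> heads_below (PMu P) (PMu P').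
Proof.
  intros E HPP n H HH.
  destruct (proc_head_mu_inv _ _ _ HH) as [m [H0 [Hm [N ->]]]].
  destruct (HPP _ _ Hm) as [m' [H0' [Hm' HE]]].
  exists (S m'), (proc_subst (unfolding P') H0'). split.
  (* [head_eq] relates [PVar 0] only to itself, so the head of [P'] is not the bound variable
     either. *)
  - apply proc_head_mu; [exact Hm'|]. intros ->. inversion HE; subst. now elim N.
  - now apply head_eq_unfolding.
Qed.

(** Both directions are carried together so that the case [peq_sym] merely swaps the induction
    hypotheses. *)
Lemma proc_eq_heads_both P Q : proc_eq P Q -> heads_below P Q /\ heads_below Q P.
Proof.
  induction 1 as [P|P|P Q _ [IH1 IH2]|P Q R _ [IH1 IH2] _ [IH3 IH4]
    |p l P P' E _|p l e P P' E _|P P' Q Q' E _ E' _|e P P' Q Q' E _ E' _|P P' E [IH1 IH2]];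
    try (split; apply heads_below_same; simpl; auto; constructor; auto using peq_sym; fail).
  - split; intros n H HH.
    + inversion HH as [? h|]; subst; [now elim h|].
      eauto 6 using head_eq_refl, proc_head_not_mu.
    + exists (S n), H. split; [now constructor|eauto using head_eq_refl, proc_head_not_mu].
  - split; intros n H HH; eauto 6 using head_eq_refl, proc_head_not_mu.
  - auto.
  - split; intros n H HH.
    + destruct (IH1 _ _ HH) as [m [H' [Hm E]]]. destruct (IH3 _ _ Hm) as [k [H'' [Hk E']]].
      eauto using head_eq_trans.
    + destruct (IH4 _ _ HH) as [m [H' [Hm E]]]. destruct (IH2 _ _ Hm) as [k [H'' [Hk E']]].
      eauto using head_eq_trans.
  - split; apply heads_below_mu; auto using peq_sym.
Qed.

Lemma proc_eq_heads P Q : proc_eq P Q -> heads_below P Q.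
Proof. apply proc_eq_heads_both. Qed.

(* The summands of P when mu's may sit between the sums. *)
Inductive summand : proc -> participant -> label -> proc -> Prop :=
| sm_in n P q l R : proc_head n P (PIn q l R) -> summand P q l R
| sm_plus_l n P P1 P2 q l R :
    proc_head n P (PPlus P1 P2) -> summand P1 q l R -> summand P q l R
| sm_plus_r n P P1 P2 q l R :
    proc_head n P (PPlus P1 P2) -> summand P2 q l R -> summand P q l R.

Lemma summand_proc_eq P P' q l R :
  summand P q l R -> proc_eq P P' -> exists R', summand P' q l R' /\ proc_eq R R'.
Proof.
  intros H. revert P'.
  induction H as [n P q l R HP|n P P1 P2 q l R HP _ IH|n P P1 P2 q l R HP _ IH];
    intros P' E; destruct (proc_eq_heads _ _ E _ _ HP) as [m [H' [HP' HE]]];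
    inversion HE; subst.
  - eauto using sm_in.
  - destruct (IH _ H1) as [R' [? ?]]. eauto using sm_plus_l.
  - destruct (IH _ H3) as [R' [? ?]]. eauto using sm_plus_r.
Qed.

Lemma summand_subst s P q l R :
  summand P q l R ->
  summand (proc_subst s P) q l
    (proc_subst (fun X => proc_ren S (fun Y => Y) (s X)) R).
Proof.
  induction 1 as [n P q l R HP|n P P1 P2 q l R HP _ IH|n P P1 P2 q l R HP _ IH];
    apply proc_head_subst with (s := s) in HP; simpl in *;
    eauto using sm_in, sm_plus_l, sm_plus_r.
Qed.

Lemma is_sum_summand P Ps q l R : is_sum P Ps -> In (PIn q l R) Ps -> summand P q l R.
Proof.
  induction 1 as [P|P Q Ps Qs _ IHP _ IHQ]; intros H.
  - destruct H as [->|[]]. apply (sm_in 0). now constructor.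
  - apply in_app_or in H. destruct H as [H|H].
    + apply (sm_plus_l 0 _ P Q); [constructor; auto|auto].
    + apply (sm_plus_r 0 _ P Q); [constructor; auto|auto].
Qed.

(** When the listed summands are inputs, no recursion intervenes on the way to a leaf, so every head
    is reached with zero unfoldings. *)
Lemma summand_is_sum P Ps q l R :
  is_sum P Ps -> (forall Q, In Q Ps -> exists q l R, Q = PIn q l R) ->
  summand P q l R -> In (PIn q l R) Ps.
Proof.
  intros H. revert q l R.
  induction H as [P|P Q Ps Qs _ IHP _ IHQ]; intros q l R HPs H.
  - destruct (HPs P) as [q' [l' [R' ->]]]; [now left|].
    inversion H as [n ? ? ? ? HP|n ? P1 P2 ? ? ? HP _|n ? P1 P2 ? ? ? HP _]; subst;
      inversion HP; subst; now left.
  - apply in_or_app.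
    inversion H as [n ? ? ? ? HP|n ? P1 P2 ? ? ? HP HS|n ? P1 P2 ? ? ? HP HS]; subst;
      inversion HP; subst.
    + left. apply IHP; [|assumption]. intros. apply HPs, in_or_app. auto.
    + right. apply IHQ; [|assumption]. intros. apply HPs, in_or_app. auto.
Qed.

(** * Typing *)

Lemma expr_typing_ren f G G' e s :
  (forall x s, nth_error G x = Some s -> nth_error G' (f x) = Some s) ->
  expr_typing G e s -> expr_typing G' (expr_ren f e) s.
Proof. intros Hf. induction 1; simpl; eauto using expr_typing. Qed.

Lemma is_sum_map (f : proc -> proc) P Ps :
  (forall P Q, f (PPlus P Q) = PPlus (f P) (f Q)) -> is_sum P Ps -> is_sum (f P) (map f Ps).
Proof.
  intros Hf. induction 1; simpl; [constructor|].
  rewrite Hf, map_app. now constructor.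
Qed.

(** The input case common to renaming and substitution: [f] is the operation outside the input
    binder and [h] the same operation under it. *)
Lemma typing_in_map (f h : proc -> proc) G D G0 D0 q (I : list (label * sort * proc * stype)) Q :
  (forall P Q, f (PPlus P Q) = PPlus (f P) (f Q)) ->
  (forall l P, f (PIn q l P) = PIn q l (h P)) ->
  is_sum Q (map (fun '(l, _, P, _) => PIn q l P) I) ->
  (forall l s P T, In (l, s, P, T) I -> typing (s :: G0) D0 P T -> typing (s :: G) D (h P) T) ->
  (forall l s P T, In (l, s, P, T) I -> typing (s :: G0) D0 P T) ->
  session_type (TIn q (map (fun '(l, s, _, T) => (l, s, T)) I)) ->
  typing G D (f Q) (TIn q (map (fun '(l, s, _, T) => (l, s, T)) I)).
Proof.
  intros Hplus Hin HQ Hh HI HT.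
  assert (E : map (fun '(l, s, _, T) => (l, s, T)) I =
    map (fun '(l, s, _, T) => (l, s, T)) (map (fun '(l, s, P, T) => (l, s, h P, T)) I)).
  { rewrite map_map. apply map_ext. now intros [[[l s] P] T]. }
  rewrite E in *. apply pt_in; [| |assumption].
  - apply (is_sum_map f) in HQ; [|assumption].
    rewrite map_map in *. erewrite map_ext; [exact HQ|].
    intros [[[l s] P] T]. now rewrite Hin.
  - intros l s P T H. apply in_map_iff in H.
    destruct H as [[[[l0 s0] P0] T0] [E0 H]]. injection E0 as <- <- <- <-. eauto.
Qed.

Lemma typing_ren f g G D G' D' P T :
  typing G D P T ->
  (forall x s, nth_error G x = Some s -> nth_error G' (f x) = Some s) ->
  (forall X U, nth_error D X = Some U -> nth_error D' (g X) = Some U) ->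
  typing G' D' (proc_ren f g P) T.
Proof.
  intros H. revert f g G' D'.
  induction H as [G D q I Q HQ HI IH HT|G D|G D q l e P s T He HP IH
    |G D e P1 P2 T1 T2 T He H1 IH1 H2 IH2 HU HT|G D P T HT HP IH|G D X T HX
    |G D P T T' HP IH Hsub HT'|G D P Q T E HP IH]; intros f g G' D' Hf Hg; simpl.
  - apply (typing_in_map (proc_ren f g) (proc_ren (up_ren f) g) G' D' G D); auto.
    intros l s P T Hb _. eapply IH; eauto. intros [|x]; simpl; auto.
  - constructor.
  - econstructor; eauto using expr_typing_ren.
  - econstructor; eauto using expr_typing_ren.
  - constructor; [assumption|]. apply IH; auto. intros [|X]; simpl; auto.
  - constructor. auto.
  - eapply pt_sub; eauto.
  - eapply pt_eq; [|eauto]. now apply proc_eq_ren.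
Qed.

Lemma typing_subst s G D D' P T :
  typing G D P T ->
  (forall X U, nth_error D X = Some U -> typing G D' (s X) U) ->
  typing G D' (proc_subst s P) T.
Proof.
  intros H. revert s D'.
  induction H as [G D q I Q HQ HI IH HT|G D|G D q l e P s T He HP IH
    |G D e P1 P2 T1 T2 T He H1 IH1 H2 IH2 HU HT|G D P T HT HP IH|G D X T HX
    |G D P T T' HP IH Hsub HT'|G D P Q T E HP IH]; intros z D' Hz; simpl.
  - apply (typing_in_map (proc_subst z)
      (proc_subst (fun X => proc_ren S (fun Y => Y) (z X))) G D' G D); auto.
    intros l s P T Hb _. eapply IH; eauto.
    intros X U HX. eapply typing_ren; eauto.
  - constructor.
  - econstructor; eauto.
  - econstructor; eauto.
  - constructor; [assumption|]. apply IH.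
    intros [|X] U HX; simpl in *.
    + constructor. exact HX.
    + eapply typing_ren; eauto.
  - auto.
  - eapply pt_sub; eauto.
  - eapply pt_eq; [|eauto]. now apply proc_eq_subst_l.
Qed.

(** * Inversion of typing at heads *)

Lemma typing_subst_unfolding G D P Q T U :
  typing G (T :: D) Q U -> typing G D (PMu P) T ->
  typing G D (proc_subst (unfolding P) Q) U.
Proof.
  intros HQ HP. apply (typing_subst _ _ _ _ _ _ HQ).
  intros [|X] V HV; simpl in *; [now injection HV as <-|now constructor].
Qed.

(** The quantifier ranges over the branches of the type and not over the summands, since subtyping
    may forget branches. The sort [s] used by the process may be larger than the declared [s'] by
    contravariance. *)
Definition inverts_in (G : list sort) (D : list stype) (H : proc) (T : stype) : Prop :=
  exists q bs, type_head T (TIn q bs) /\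
    forall l s' U, In (l, s', U) bs ->
      exists R s, summand H q l R /\ subsort s' s /\ typing (s :: G) D R U.

(** Both arms of a conditional receive the whole type [T], because the operands of a union are
    subtypes of it. A [PMu] never occurs as a head. *)
Definition inverts (G : list sort) (D : list stype) (H : proc) (T : stype) : Prop :=
  match H with
  | PIn _ _ _ | PPlus _ _ => inverts_in G D H T
  | POut q l e P =>
      exists bs s U, type_head T (TOut q bs) /\ In (l, s, U) bs /\
        expr_typing G e s /\ typing G D P U
  | PIf e P1 P2 => expr_typing G e SBool /\ typing G D P1 T /\ typing G D P2 T
  | PNil => type_head T TEnd
  | PMu _ | PVar _ => True
  end.

Lemma inverts_in_sub G D H T T' :
  inverts_in G D H T -> subtype T T' -> session_type T' -> inverts_in G D H T'.
Proof.
  intros [q [bs [HT Hbs]]] Hsub HT'.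
  destruct Hsub as [T T' h h'|T T' p cs cs' h h' i|T T' p cs cs' h h' i];
    pose proof (type_head_det _ _ _ HT h) as E; try discriminate E.
  injection E as <- <-. exists q, cs'. split; [exact h'|].
  intros l s' U Hb. destruct (i _ _ _ Hb) as [s1 [U1 [Hb1 [Hs HU]]]].
  destruct (Hbs _ _ _ Hb1) as [R [s [HR [Hs1 Hty]]]].
  exists R, s. split; [exact HR|]. split; [eauto using subsort_trans|].
  eapply pt_sub; eauto using session_type_in, type_head_session.
Qed.

Lemma inverts_sub G D H T T' :
  inverts G D H T -> subtype T T' -> session_type T' -> inverts G D H T'.
Proof.
  destruct H as [q l P|q l e P|P Q|e P Q|P|X|]; simpl; intros HI Hsub HT';
    eauto using inverts_in_sub.
  - destruct HI as [bs [s [U [HT [Hb [He HP]]]]]].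
    destruct Hsub as [T T' h h'|T T' p cs cs' h h' i|T T' p cs cs' h h' i];
      pose proof (type_head_det _ _ _ HT h) as E; try discriminate E.
    injection E as <- <-. destruct (i _ _ _ Hb) as [s' [U' [Hb' [Hs HU]]]].
    exists cs', s', U'. split; [exact h'|]. split; [exact Hb'|].
    split; [eapply et_sub; eauto|].
    eapply pt_sub; eauto using session_type_out, type_head_session.
  - destruct HI as [He [H1 H2]]. split; [exact He|]. split; eapply pt_sub; eauto.
  - destruct Hsub as [T T' h h'|T T' p cs cs' h h' i|T T' p cs cs' h h' i];
      pose proof (type_head_det _ _ _ HI h) as E; congruence.
Qed.

Lemma inverts_in_proc_eq G D H H' T :
  inverts_in G D H T -> proc_eq H H' -> inverts_in G D H' T.
Proof.
  intros [q [bs [HT Hbs]]] E. exists q, bs. split; [exact HT|].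
  intros l s' U Hb. destruct (Hbs _ _ _ Hb) as [R [s [HR [Hs Hty]]]].
  destruct (summand_proc_eq _ _ _ _ _ HR E) as [R' [HR' E']].
  exists R', s. eauto using pt_eq.
Qed.

Lemma inverts_head_eq G D H H' T : inverts G D H T -> head_eq H H' -> inverts G D H' T.
Proof.
  intros HI HE.
  destruct HE as [p l P P' E|p l e P P' E|P P' Q Q' E E'|e P P' Q Q' E E'|X|];
    simpl in *; auto.
  - exact (inverts_in_proc_eq _ _ _ _ _ HI (peq_in _ _ _ _ E)).
  - destruct HI as [bs [s [U [HT [Hb [He HP]]]]]].
    exists bs, s, U. repeat split; auto. exact (pt_eq _ _ _ _ _ E HP).
  - exact (inverts_in_proc_eq _ _ _ _ _ HI (peq_plus _ _ _ _ E E')).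
  - destruct HI as [He [H1 H2]]. eauto using pt_eq.
Qed.

Lemma inverts_in_unfolding G D P H T U :
  inverts_in G (U :: D) H T -> typing G D (PMu P) U ->
  inverts_in G D (proc_subst (unfolding P) H) T.
Proof.
  intros [q [bs [HT Hbs]]] HP. exists q, bs. split; [exact HT|].
  intros l s' V Hb. destruct (Hbs _ _ _ Hb) as [R [s [HR [Hs Hty]]]].
  eexists _, s. split; [apply summand_subst, HR|]. split; [exact Hs|].
  eapply typing_subst; [exact Hty|].
  intros [|X] W HX; simpl in *.
  - injection HX as <-. apply (typing_ren S (fun Y => Y) _ _ _ _ _ _ HP); auto.
  - now constructor.
Qed.

(** Serves the rule [pt_mu]: what is known of the head of the body, typed under the assumption [U],
    is transferred to its instance in which the recursion itself, of type [U], replaces the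
    variable. *)
Lemma inverts_unfolding G D P H T U :
  inverts G (U :: D) H T -> typing G D (PMu P) U -> ~ is_mu H -> H <> PVar 0 ->
  inverts G D (proc_subst (unfolding P) H) T.
Proof.
  destruct H as [q l Q|q l e Q|Q1 Q2|e Q1 Q2|Q|[|X]|]; intros HI HP HM N;
    simpl in HM; try contradiction; simpl in *; auto.
  - exact (inverts_in_unfolding _ _ _ _ _ _ HI HP).
  - destruct HI as [bs [s [V [HT [Hb [He HQ]]]]]].
    exists bs, s, V. eauto 6 using typing_subst_unfolding.
  - exact (inverts_in_unfolding _ _ _ _ _ _ HI HP).
  - destruct HI as [He [H1 H2]]. eauto using typing_subst_unfolding.
Qed.

Lemma typing_inversion G D P T n H : typing G D P T -> proc_head n P H -> inverts G D H T.
Proof.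
  intros Hty. revert n H.
  induction Hty as [G D q I Q HQ HI IH HT|G D|G D q l e P s T He HP IH
    |G D e P1 P2 T1 T2 T He H1 IH1 H2 IH2 HU HT|G D P T HT HP IH|G D X T HX
    |G D P T T' HP IH Hsub HT'|G D P Q T E HP IH]; intros n H HH.
  - assert (HI' : inverts_in G D Q (TIn q (map (fun '(l, s, _, T) => (l, s, T)) I))).
    { eexists q, _. split; [constructor|]. intros l s U Hb.
      apply in_map_iff in Hb. destruct Hb as [[[[l0 s0] R] U0] [E Hb]].
      injection E as -> -> ->. exists R, s.
      split; [|eauto using subsort_refl].
      apply (is_sum_summand _ _ _ _ _ HQ). apply in_map_iff.
      now exists (l, s, R, U). }
    (* [inverts] computes on the root of [Q]: a sum with one summand is an input, as that summand
       comes from [I]; any other has root [PPlus]. *)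
    assert (HQ' : inverts G D Q (TIn q (map (fun '(l, s, _, T) => (l, s, T)) I))).
    { remember (map (fun '(l, _, P, _) => PIn q l P) I) as Ps eqn:E.
      destruct HQ as [Q|P Q Ps Qs HP HQ]; [|exact HI'].
      destruct I as [|[[[l s] R] U] I]; [discriminate|].
      injection E as -> _. exact HI'. }
    inversion HH; subst; [assumption|]. exfalso. inversion HQ; subst.
    destruct I as [|[[[l s] R] U] I]; discriminate.
  - inversion HH; subst. constructor.
  - inversion HH; subst. exists [(l, s, T)], s, T.
    repeat split; auto; [constructor|now left].
  - inversion HH; subst. destruct (type_union_subtype _ _ _ HU).
    repeat split; eauto using pt_sub.
  - destruct (proc_head_mu_inv _ _ _ HH) as [m [H0 [Hm [N ->]]]].
    apply inverts_unfolding with (U := T); eauto using proc_head_not_mu, pt_mu.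
  - inversion HH; subst. constructor.
  - eapply inverts_sub; eauto.
  (* The given head belongs to [Q], while the induction hypothesis speaks of [P], so the congruence
     is followed backwards and its result is transported by [head_eq]. *)
  - destruct (proc_eq_heads _ _ (peq_sym _ _ E) _ _ HH) as [m [H' [Hm HE]]].
    eapply inverts_head_eq; [eauto|]. now apply head_eq_sym.
Qed.

(** * Characteristic processes *)

(* [test s] is a boolean expression in the variable just received; it is typable
   exactly when the sort of that variable is a subsort of [s]. *)
Definition test (s : sort) : expr :=
  match s with
  | SNat => EGt (ESucc (EVar 0)) (EVal (VNat 0))
  | SInt => EGt (EVar 0) (EVal (VNat 0))
  | SBool => ENot (EVar 0)
  end.

(** For [SInt] the value is [VInt 0], since [VNat 0] would also have sort [SNat]. *)
Definition sample (s : sort) : expr :=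
  match s with
  | SNat => EVal (VNat 0)
  | SInt => EVal (VInt 0)
  | SBool => EVal (VBool true)
  end.

(** Any derivation may end with [et_sub], so inversion for expressions goes by induction on the
    derivation. *)
Lemma expr_typing_var_inv G x s :
  expr_typing G (EVar x) s -> exists s0, nth_error G x = Some s0 /\ subsort s0 s.
Proof.
  intros H. remember (EVar x) as e eqn:E. induction H; try discriminate.
  - injection E as ->. eauto using subsort_refl.
  - destruct (IHexpr_typing E) as [s0 [? ?]]. eauto using subsort_trans.
Qed.

Lemma expr_typing_gt_inv G e1 e2 s : expr_typing G (EGt e1 e2) s -> expr_typing G e1 SInt.
Proof.
  intros H. remember (EGt e1 e2) as e eqn:E. induction H; try discriminate; auto.
  now injection E as -> ->.
Qed.

Lemma expr_typing_succ_inv G e s : expr_typing G (ESucc e) s -> expr_typing G e SNat.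
Proof.
  intros H. remember (ESucc e) as e' eqn:E. induction H; try discriminate; auto.
  now injection E as ->.
Qed.

Lemma expr_typing_not_inv G e s : expr_typing G (ENot e) s -> expr_typing G e SBool.
Proof.
  intros H. remember (ENot e) as e' eqn:E. induction H; try discriminate; auto.
  now injection E as ->.
Qed.

Lemma expr_typing_val_inv G v s :
  expr_typing G (EVal v) s ->
  subsort (match v with VNat _ => SNat | VInt _ => SInt | VBool _ => SBool end) s.
Proof.
  intros H. remember (EVal v) as e eqn:E.
  induction H; try discriminate; try (injection E as <-; apply subsort_refl).
  eauto using subsort_trans.
Qed.

Lemma subsort_nat_int : subsort SNat SInt.
Proof. apply rt_step. constructor. Qed.

Lemma test_typing G s : expr_typing (s :: G) (test s) SBool.
Proof.
  assert (Hzero : expr_typing (s :: G) (EVal (VNat 0)) SInt)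
    by (eapply et_sub; [constructor|apply subsort_nat_int]).
  destruct s; simpl.
  - apply et_gt; [|exact Hzero].
    eapply et_sub; [|apply subsort_nat_int]. apply et_succ. now constructor.
  - apply et_gt; [now constructor|exact Hzero].
  - apply et_not. now constructor.
Qed.

Lemma test_typing_inv G s s' u : expr_typing (s' :: G) (test s) u -> subsort s' s.
Proof.
  intros H.
  assert (Hv : expr_typing (s' :: G) (EVar 0) s).
  { destruct s; simpl in H.
    - eapply expr_typing_succ_inv, expr_typing_gt_inv, H.
    - eapply expr_typing_gt_inv, H.
    - eapply expr_typing_not_inv, H. }
  apply expr_typing_var_inv in Hv. destruct Hv as [s0 [E Hs]].
  injection E as <-. exact Hs.
Qed.

Lemma sample_typing G s : expr_typing G (sample s) s.
Proof. destruct s; constructor. Qed.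

Lemma sample_typing_inv G s s' : expr_typing G (sample s) s' -> subsort s s'.
Proof. destruct s; apply expr_typing_val_inv. Qed.

(* [psum] and [pchoice] are only meaningful on nonempty lists. *)
Fixpoint psum (Ps : list proc) : proc :=
  match Ps with
  | [] => PNil
  | [P] => P
  | P :: Ps => PPlus P (psum Ps)
  end.

Fixpoint pchoice (Ps : list proc) : proc :=
  match Ps with
  | [] => PNil
  | [P] => P
  | P :: Ps => PIf (EVal (VBool true)) P (pchoice Ps)
  end.

(** Type variables keep their indices as process variables, since [TMu] and [PMu] bind alike. Under
    an input the continuation fills both arms of the conditional, so the test constrains the
    received sort without affecting the type of what follows. *)
Fixpoint char (T : stype) : proc :=
  match T with
  | TEnd => PNil
  | TIn p bs =>
      psum (map (fun b => PIn p (fst (fst b))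
        (PIf (test (snd (fst b))) (char (snd b)) (char (snd b)))) bs)
  | TOut p bs =>
      pchoice (map (fun b => POut p (fst (fst b)) (sample (snd (fst b))) (char (snd b))) bs)
  | TMu T => PMu (char T)
  | TVar t => PVar t
  end.

Lemma psum_map (f : proc -> proc) Ps :
  f PNil = PNil -> (forall P Q, f (PPlus P Q) = PPlus (f P) (f Q)) ->
  f (psum Ps) = psum (map f Ps).
Proof.
  intros H0 H. induction Ps as [|P [|Q Ps] IH]; auto.
  change (f (PPlus P (psum (Q :: Ps))) = PPlus (f P) (psum (map f (Q :: Ps)))).
  now rewrite H, IH.
Qed.

Lemma pchoice_map (f : proc -> proc) Ps :
  f PNil = PNil ->
  (forall P Q, f (PIf (EVal (VBool true)) P Q) = PIf (EVal (VBool true)) (f P) (f Q)) ->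
  f (pchoice Ps) = pchoice (map f Ps).
Proof.
  intros H0 H. induction Ps as [|P [|Q Ps] IH]; auto.
  change (f (PIf (EVal (VBool true)) P (pchoice (Q :: Ps))) =
    PIf (EVal (VBool true)) (f P) (pchoice (map f (Q :: Ps)))).
  now rewrite H, IH.
Qed.

Lemma psum_is_sum Ps : Ps <> [] -> is_sum (psum Ps) Ps.
Proof.
  intros N. induction Ps as [|P [|Q Ps] IH]; [now elim N|constructor|].
  apply (is_sum_plus P (psum (Q :: Ps)) [P]); [constructor|]. now apply IH.
Qed.

(** The renaming [f] disappears because each test mentions only the variable bound by the input
    directly above it. *)
Lemma char_ren f g T : proc_ren f g (char T) = char (type_ren g T).
Proof.
  revert f g.
  induction T as [|p bs IH|p bs IH|T IH|t] using stype_ind_nested; intros f g; simpl.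
  - reflexivity.
  - rewrite psum_map by reflexivity. rewrite !map_map. f_equal.
    apply map_ext_in. intros [[l s] T] Hb. simpl.
    rewrite (IH _ _ _ Hb). now destruct s.
  - rewrite pchoice_map by reflexivity. rewrite !map_map. f_equal.
    apply map_ext_in. intros [[l s] T] Hb. simpl.
    rewrite (IH _ _ _ Hb). now destruct s.
  - now rewrite IH.
  - reflexivity.
Qed.

Lemma char_subst s T : proc_subst (fun t => char (s t)) (char T) = char (type_subst s T).
Proof.
  revert s.
  induction T as [|p bs IH|p bs IH|T IH|t] using stype_ind_nested; intros s; simpl.
  - reflexivity.
  - rewrite psum_map by reflexivity. rewrite !map_map. f_equal.
    apply map_ext_in. intros [[l s'] T] Hb. simpl.
    rewrite <- (IH _ _ _ Hb).
    rewrite (proc_subst_ext (fun X => proc_ren S (fun Y => Y) (char (s X)))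
      (fun t => char (s t))); [reflexivity|].
    intros X. rewrite char_ren. now rewrite type_ren_id.
  - rewrite pchoice_map by reflexivity. rewrite !map_map. f_equal.
    apply map_ext_in. intros [[l s'] T] Hb. simpl. now rewrite (IH _ _ _ Hb).
  - rewrite <- IH. f_equal. apply proc_subst_ext. intros [|t]; simpl; [reflexivity|].
    apply char_ren.
  - reflexivity.
Qed.

Lemma char_unfold T : proc_unfold (char T) = char (type_unfold T).
Proof.
  unfold type_unfold. rewrite <- char_subst. apply proc_subst_ext. now intros [|t].
Qed.

Lemma psum_not_mu Ps : (forall P, In P Ps -> ~ is_mu P) -> ~ is_mu (psum Ps).
Proof.
  destruct Ps as [|P [|Q Ps]]; simpl; auto.
Qed.

Lemma pchoice_not_mu Ps : (forall P, In P Ps -> ~ is_mu P) -> ~ is_mu (pchoice Ps).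
Proof.
  destruct Ps as [|P [|Q Ps]]; simpl; auto.
Qed.

Lemma char_head T U : type_head T U -> exists n, proc_head n (char T) (char U).
Proof.
  induction 1 as [|p bs|p bs|T U _ [n IH]].
  - exists 0. now constructor.
  - exists 0. constructor. apply psum_not_mu. intros P HP.
    apply in_map_iff in HP. now destruct HP as [b [<- _]].
  - exists 0. constructor. apply pchoice_not_mu. intros P HP.
    apply in_map_iff in HP. now destruct HP as [b [<- _]].
  - exists (S n). simpl. constructor. now rewrite char_unfold.
Qed.

(** * Well-formedness and typing of characteristic processes *)

Lemma psum_guards X Ps : (forall P, In P Ps -> proc_guards X P) -> proc_guards X (psum Ps).
Proof.
  induction Ps as [|P [|Q Ps] IH]; intros H; [exact I|apply H; now left|].
  split; [apply H; now left|]. apply IH. intros R HR. apply H. now right.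
Qed.

Lemma pchoice_guards X Ps : (forall P, In P Ps -> proc_guards X P) -> proc_guards X (pchoice Ps).
Proof.
  induction Ps as [|P [|Q Ps] IH]; intros H; [exact I|apply H; now left|].
  split; [apply H; now left|]. apply IH. intros R HR. apply H. now right.
Qed.

Lemma psum_wf m k Ps : (forall P, In P Ps -> proc_wf m k P) -> proc_wf m k (psum Ps).
Proof.
  induction Ps as [|P [|Q Ps] IH]; intros H; [exact I|apply H; now left|].
  split; [apply H; now left|]. apply IH. intros R HR. apply H. now right.
Qed.

Lemma pchoice_wf m k Ps : (forall P, In P Ps -> proc_wf m k P) -> proc_wf m k (pchoice Ps).
Proof.
  induction Ps as [|P [|Q Ps] IH]; intros H; [exact I|apply H; now left|].
  split; [exact I|]. split; [apply H; now left|]. apply IH. intros R HR. apply H. now right.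
Qed.

Lemma char_guards t T : type_guards t T -> proc_guards t (char T).
Proof.
  revert t. induction T as [|p bs _|p bs _|T IH|u] using stype_ind_nested; intros t H; simpl in *.
  - exact I.
  - apply psum_guards. intros P HP. apply in_map_iff in HP. now destruct HP as [b [<- _]].
  - apply pchoice_guards. intros P HP. apply in_map_iff in HP. now destruct HP as [b [<- _]].
  - now apply IH.
  - exact H.
Qed.

Lemma char_wf m k T : type_wf k T -> proc_wf m k (char T).
Proof.
  revert m k.
  induction T as [|p bs IH|p bs IH|T IH|u] using stype_ind_nested; intros m k H;
    inversion H; subst; simpl.
  - exact I.
  - apply psum_wf. intros P HP. apply in_map_iff in HP. destruct HP as [[[l s] T] [<- Hb]].
    simpl. split; [destruct s; simpl; repeat split; lia|]. split; eauto.
  - apply pchoice_wf. intros P HP. apply in_map_iff in HP. destruct HP as [[[l s] T] [<- Hb]].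
    simpl. split; [now destruct s|eauto].
  - split; [now apply char_guards|now apply IH].
  - assumption.
Qed.

Lemma pchoice_typing G D p (Ps : list proc) (bs : branches) :
  Forall2 (fun P b => typing G D P (TOut p [b])) Ps bs ->
  session_type (TOut p bs) -> typing G D (pchoice Ps) (TOut p bs).
Proof.
  intros H. induction H as [|P b Ps bs HP HPs IH]; intros HT.
  - inversion HT as [| |? ? ? [N _]| |]. now elim N.
  - destruct HPs as [|Q c Ps bs HQ HPs]; [exact HP|].
    apply (pt_if _ _ _ P (pchoice (Q :: Ps)) (TOut p [b]) (TOut p (c :: bs))).
    + constructor.
    + exact HP.
    + apply IH. inversion HT as [| |? ? ? [_ Hnd] Hbs| |]; subst.
      constructor; [split; [discriminate|now inversion Hnd]|].
      intros l s T Hb. apply (Hbs l s). now right.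
    (* Appending the tail to the singleton [[b]] gives the goal list by computation, so reflexivity
       of [type_eq] suffices. *)
    + eapply union_out; [constructor|constructor|]. now apply type_eq_refl.
    + exact HT.
Qed.

(** Generalised to open types for the induction: [z] closes the free type variables, and the process
    variable [t] is assumed to have type [z t]. *)
Lemma char_typing G D k T z :
  type_wf k T ->
  (forall t, t < k -> nth_error D t = Some (z t) /\ session_type (z t)) ->
  typing G D (char T) (type_subst z T).
Proof.
  revert G D k z.
  induction T as [|p bs IH|p bs IH|T IH|u] using stype_ind_nested; intros G D k z HT Hz.
  - constructor.
  - assert (HT' : session_type (type_subst z (TIn p bs)))
      by (apply (type_wf_subst _ k); [apply Hz|exact HT]).
    simpl in *.
    set (I := map (fun b => (fst b, PIf (test (snd (fst b))) (char (snd b)) (char (snd b)),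
      type_subst z (snd b))) bs).
    assert (E : map (fun b => (fst b, type_subst z (snd b))) bs =
      map (fun '(l, s, _, T) => (l, s, T)) I).
    { unfold I. rewrite map_map. apply map_ext. now intros [[l s] T]. }
    rewrite E in *. apply pt_in; [| |exact HT'].
    + replace (map _ I) with (map (fun b => PIn p (fst (fst b))
        (PIf (test (snd (fst b))) (char (snd b)) (char (snd b)))) bs).
      * apply psum_is_sum. inversion HT as [|? ? ? [N _]| | |]; subst.
        intros E'. apply map_eq_nil in E'. contradiction.
      * unfold I. rewrite map_map. apply map_ext. now intros [[l s] T].
    + intros l s P U Hb. apply in_map_iff in Hb. destruct Hb as [[[l0 s0] T] [E' Hb]].
      simpl in E'. injection E' as -> -> <- <-.
      inversion HT as [|? ? ? _ Hbs| | |]; subst.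
      assert (HU : session_type (type_subst z T))
        by (apply (type_wf_subst _ k); [apply Hz|eauto]).
      eapply pt_if; eauto using test_typing.
      apply union_idem; now apply type_eq_refl.
  - assert (HT' : session_type (type_subst z (TOut p bs)))
      by (apply (type_wf_subst _ k); [apply Hz|exact HT]).
    simpl in *. apply pchoice_typing; [|exact HT'].
    inversion HT as [| |? ? ? _ Hbs| |]; subst. clear HT HT'.
    induction bs as [|[[l s] T] bs IHbs]; simpl; constructor.
    + constructor; [apply sample_typing|]. apply (IH l s T) with (k := k); [now left| |exact Hz].
      apply (Hbs l s). now left.
    + apply IHbs; intros l' s' T' Hb; [apply (IH l' s')|apply (Hbs l' s')]; now right.
  - assert (HT' : session_type (type_subst z (TMu T)))
      by (apply (type_wf_subst _ k); [apply Hz|exact HT]).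
    simpl in *. inversion HT; subst. apply pt_mu; [exact HT'|].
    (* The induction hypothesis types the body with the unfolding of the recursive type, whereas
       [pt_mu] asks for the recursive type itself. *)
    eapply pt_sub; [|apply type_eq_subtype, type_eq_unfold, HT'|exact HT'].
    rewrite type_unfold_up. eapply IH; [eassumption|].
    intros [|t] Ht; simpl; [auto|]. apply Hz. lia.
  - inversion HT; subst. simpl. constructor. now apply Hz.
Qed.

Lemma char_denotation T : session_type T -> denotation T (char T).
Proof.
  intros HT. split; [now apply char_wf|].
  rewrite <- (type_subst_id TVar T) at 2 by reflexivity.
  apply (char_typing _ _ 0); [exact HT|]. lia.
Qed.

(** * Leastness of the type of a characteristic process *)

Lemma inverts_pchoice G D Ps T P :
  (forall P, In P Ps -> ~ is_mu P) ->
  inverts G D (pchoice Ps) T -> In P Ps -> inverts G D P T.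
Proof.
  induction Ps as [|Q [|R Ps] IH]; intros HPs HT HP.
  - destruct HP.
  - destruct HP as [<-|[]]. exact HT.
  - destruct HT as [_ [H1 H2]].
    assert (HRPs : forall P, In P (R :: Ps) -> ~ is_mu P)
      by (intros P' HP'; apply HPs; now right).
    destruct HP as [<-|HP].
    + apply (typing_inversion _ _ _ _ 0 _ H1). constructor. apply HPs. now left.
    + apply IH; [exact HRPs| |exact HP].
      apply (typing_inversion _ _ _ _ 0 _ H2). constructor. now apply pchoice_not_mu.
Qed.

Lemma char_principal G T T' :
  session_type T -> session_type T' -> typing G [] (char T) T' -> subtype T T'.
Proof.
  intros HT HT' H.
  (* The environment [G] is existential because passing under an input extends it by the sort of the
     received variable. *)
  apply (subtype_coind (fun T T' => session_type T /\ session_type T' /\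
    exists G, typing G [] (char T) T')); [|eauto].
  clear. intros T T' [HT [HT' [G H]]].
  destruct (type_head_exists T HT) as [U HU].
  pose proof (type_head_session _ _ HU HT) as HwU.
  destruct (char_head _ _ HU) as [n Hn].
  pose proof (typing_inversion _ _ _ _ _ _ H Hn) as HI.
  destruct U as [|p bs|p bs|U|t].
  - now apply ss_end.
  - inversion HwU as [|? ? ? [N _] Hbs| | |]; subst.
    assert (HI' : inverts_in G [] (char (TIn p bs)) T').
    { destruct bs as [|b [|c bs]]; [now elim N|exact HI|exact HI]. }
    destruct HI' as [q [cs [Hq Hcs]]].
    assert (Hsum : forall l R, summand (char (TIn p bs)) q l R ->
      q = p /\ exists s V, In (l, s, V) bs /\ R = PIf (test s) (char V) (char V)).
    { intros l R HR. eapply summand_is_sum in HR.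
      2:{ apply psum_is_sum. intros E. apply map_eq_nil in E. contradiction. }
      - apply in_map_iff in HR. destruct HR as [[[l0 s] V] [E Hb]].
        injection E as -> -> <-. eauto.
      - intros Q HQ. apply in_map_iff in HQ. destruct HQ as [b [<- _]]. eauto. }
    pose proof (type_head_session _ _ Hq HT') as HwT'.
    (* [T'] is a session type, so [cs] has a branch, and the summand matching it is one of
       [char (TIn p bs)], hence addressed to [p]. *)
    assert (E : q = p).
    { inversion HwT' as [|? ? ? [N' _]| | |]; subst.
      destruct cs as [|[[l s] V] cs]; [now elim N'|].
      destruct (Hcs l s V) as [R [s' [HR _]]]; [now left|]. now apply Hsum in HR. }
    subst q. apply (ss_in _ _ _ p bs cs); [exact HU|exact Hq|].
    intros l s' V' Hb. destruct (Hcs _ _ _ Hb) as [R [s0 [HR [Hs HtyR]]]].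
    destruct (Hsum _ _ HR) as [_ [s [V [HV ->]]]].
    (* The condition bounds [s0] by [s], and an arm supplies the typing of the continuation. *)
    assert (HIR : inverts (s0 :: G) [] (PIf (test s) (char V) (char V)) V')
      by (apply (typing_inversion _ _ _ _ 0 _ HtyR); constructor; auto).
    destruct HIR as [Htest [HtyV _]].
    exists s, V. split; [exact HV|]. split; [eauto using subsort_trans, test_typing_inv|].
    eauto 6 using session_type_in.
  - assert (Hb : forall l s V, In (l, s, V) bs ->
      inverts G [] (POut p l (sample s) (char V)) T').
    { intros l s V Hb. eapply inverts_pchoice; [|exact HI|].
      - intros P HP. apply in_map_iff in HP. now destruct HP as [b [<- _]].
      - apply in_map_iff. now exists (l, s, V). }
    inversion HwU as [| |? ? ? [N _] _| |]; subst.
    destruct bs as [|[[l0 s0] V0] bs]; [now elim N|].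
    (* The first branch fixes the head of [T']; by determinism the other branches are found in the
       same list [cs]. *)
    destruct (Hb l0 s0 V0) as [cs [_ [_ [Hcs _]]]]; [now left|].
    apply (ss_out _ _ _ p _ cs HU Hcs). intros l s V HV.
    destruct (Hb _ _ _ HV) as [cs' [s' [V' [Hcs' [HV' [He HtyV]]]]]].
    pose proof (type_head_det _ _ _ Hcs Hcs') as E. injection E as <-.
    exists s', V'. split; [exact HV'|]. split; [eapply sample_typing_inv, He|].
    split; [exact (session_type_out _ _ _ _ _ HwU HV)|]. split; [|eauto].
    exact (session_type_out _ _ _ _ _ (type_head_session _ _ Hcs HT') HV').
  - exfalso. clear -HU. remember (TMu U) as V eqn:E. induction HU; congruence || auto.
  - inversion HwU. lia.
Qed.

Theorem mainTheorem2 (T T' : stype) (hT : session_type T) (hT' : session_type T') :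
  subtype T T' <-> (forall P : proc, denotation T P -> denotation T' P).
Proof.
  split.
  - intros Hsub P [HP Hty]. split; [exact HP|]. eapply pt_sub; eauto.
  - intros H. destruct (H _ (char_denotation T hT)) as [_ Hty].
    exact (char_principal _ _ _ hT hT' Hty).
Qed.
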